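(* Let $N\ge 1$ be an integer, let $a,b>0$ with $ab<1$, and let $g=s_N$ be the $N$th order B-spline. For odd integers $n\ge 3$ with $n>\frac2a+1$, let $G_n\in\mathbb{C}^{n^2\times n^2}$ be the finite Gram matrix and $G_n^{[0]}\in\mathbb{C}^{n\times n}$ its block at modulation difference $0$, and let $\lambda_1(\cdot)$ denote the minimum eigenvalue of a Hermitian matrix. If $\lambda_1(G_n^{[0]})\to 0$ as $n\to\infty$ (along odd $n$), then (1) $a\in\mathbb{Q}$; and (2) $\lambda_1(G_n)\to 0$ as $n\to\infty$.
   Context: B-splines: $s_1=\chi_{[-1/2,1/2]}$ and $s_N=s_1*s_{N-1}$ for $N\ge 2$. Index set: $\mathcal{I}_n=\{-\frac{n-1}{2},\dots,\frac{n-1}{2}\}$. Atoms: $g_{j,k}(x)=g(x-ka)e^{2\pi i jbx}$. Inner product: $\langle f,h\rangle=\int_{\mathbb{R}}f\,\overline{h}\,dx$. The finite Gram matrix has entries $(G_n)_{(j,k),(j',k')}=\langle g_{j,k},g_{j',k'}\rangle$, $j,j',k,k'\in\mathcal{I}_n$. The block $G_n^{[0]}$ has entries $(G_n^{[0]})_{k,k'}=\langle g_{j,k},g_{j,k'}\rangle=\int_{\mathbb{R}}g(x-ka)g(x-k'a)\,dx$, $k,k'\in\mathcal{I}_n$ (independent of $j$). *)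

(* Defs.v *)
From mathcomp Require Import all_boot all_order all_algebra.
From mathcomp Require Import all_classical all_reals all_analysis.
From mathcomp Require Import complex ring.

Set Implicit Arguments.
Unset Strict Implicit.
Unset Printing Implicit Defensive.

Import Order.TTheory GRing.Theory Num.Theory.
Import numFieldNormedType.Exports.

Local Open Scope classical_set_scope.
Local Open Scope ring_scope.
Local Open Scope complex_scope.

Section Bspline.
Context {R : realType}.
Local Notation mu := (@lebesgue_measure R).

Definition convolution (f h : R -> R) (x : R) : R :=
  (\int[mu]_t (f t * h (x - t)))%R.

Definition box : R -> R := \1_(`[- (1 / 2), 1 / 2] : set R).

(* Only [N >= 1] is meaningful; [bspline 0 = bspline 1] is a junk value. *)
Definition bspline (N : nat) : R -> R := iter N.-1 (convolution box) box.

End Bspline.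

Section Gabor.
Context {R : realType}.
Local Notation mu := (@lebesgue_measure R).

Definition cexpi (t : R) : R[i] := cos t +i* sin t.

(* [\int f \overline{h}], the real and imaginary parts integrated separately. *)
Definition inner (f h : R -> R[i]) : R[i] :=
  (\int[mu]_x complex.Re (f x * (h x)^*)%C)%R +i*
  (\int[mu]_x complex.Im (f x * (h x)^*)%C)%R.

Definition atom (g : R -> R) (a b : R) (j k : R) (x : R) : R[i] :=
  (g (x - k * a))%:C * cexpi (2 * pi * j * b * x).

(* The [i]-th element of {-(n-1)/2, ..., (n-1)/2}. *)
Definition idx (n : nat) (i : 'I_n) : R := i%:R - (n%:R - 1) / 2.

(* Inverse of [uncurry mxvec_index], identifying the rows and columns of an
   n^2 x n^2 matrix with pairs (j, k). *)
Definition mxvec_unindex (n : nat) (p : 'I_(n * n)) : 'I_n * 'I_n :=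
  enum_val (cast_ord (esym (mxvec_cast n n)) p).

Definition gram (g : R -> R) (a b : R) (n : nat) : 'M[R[i]]_(n * n) :=
  \matrix_(p, q)
    let: (j, k) := mxvec_unindex p in
    let: (j', k') := mxvec_unindex q in
    inner (atom g a b (idx j) (idx k)) (atom g a b (idx j') (idx k')).

(* The diagonal block of [gram] at [j = j' = 0]; by [inner_atom_same] below the
   diagonal blocks are all equal. *)
Definition gram0 (g : R -> R) (a b : R) (n : nat) : 'M[R[i]]_n :=
  \matrix_(k, k') inner (atom g a b 0 (idx k)) (atom g a b 0 (idx k')).

(* For a nonempty Hermitian matrix this infimum is the minimum of the spectrum:
   see [lambda1_hermitian] below. *)
Definition lambda1 (m : nat) (A : 'M[R[i]]_m) : R :=
  inf [set x : R | eigenvalue A x%:C].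

Lemma inner_atom_same (g : R -> R) (a b j k k' : R) :
  inner (atom g a b j k) (atom g a b j k') =
  (\int[mu]_x (g (x - k * a) * g (x - k' * a)))%R%:C.
Proof.
have E x : atom g a b j k x * ((atom g a b j k' x)^*)%C =
    (g (x - k * a) * g (x - k' * a))%:C.
  rewrite /atom /cexpi; set t := 2 * pi * j * b * x.
  have := cos2Dsin2 t; set c := cos t; set s := sin t => cs.
  simpc; congr (_ +i* _); last by ring.
  by rewrite -[RHS]mulr1 -cs; ring.
rewrite /inner; under eq_Rintegral do rewrite E.
under [X in _ +i* X]eq_Rintegral do rewrite E.
by rewrite [X in _ +i* X]/Rintegral /= integral0.
Qed.

Lemma lambda1_hermitian (m : nat) (A : 'M[R[i]]_m) :
  (0 < m)%N -> A \is hermsymmx ->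
  eigenvalue A (lambda1 A)%:C /\
  forall z, eigenvalue A z -> (lambda1 A)%:C <= z.
Proof.
move=> m0 Ah.
have Areal z : eigenvalue A z -> z = (complex.Re z)%:C.
  move=> /eigenvalueP[v vA v0].
  have /hermitian_normalmx/orthomx_spectralP AE := Ah.
  set P := spectralmx A in AE; set d := spectral_diag A in AE.
  have Pu : P \in unitmx by exact: spectral_unit.
  pose w := v *m invmx P.
  have wd : w *m diag_mx d = z *: w.
    rewrite -[LHS](mulmxK Pu) -[w *m _ *m P]mulmxA /w.
    by rewrite -mulmxA [invmx P *m _]mulmxA -AE vA -scalemxAl.
  have /rV0Pn[j wj] : w != 0.
    by apply: contraNneq v0 => w0; rewrite -[v](mulmxKV Pu) -/w w0 mul0mx.
  have /matrixP/(_ 0 j) := wd; rewrite mul_mx_diag mxE [RHS]mxE => dw.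
  have <- : d 0 j = z by apply: (mulIf wj); rewrite -dw mulrC.
  have /mxOverP/(_ 0 j) := hermitian_spectral_diag_real Ah.
  by move=> /RRe_real.
have [z0 Az0] : exists z, eigenvalue A z.
  have : size (char_poly A) != 1%N by rewrite size_char_poly; case: m m0 {A Ah Areal}.
  by move=> /closed_rootP[z rz]; exists z; rewrite eigenvalue_root_char.
have [s sE] := closed_field_poly_normal (char_poly A).
have cpm : lead_coef (char_poly A) = 1 by apply/monicP/char_poly_monic.
have Es z : eigenvalue A z = (z \in s).
  by rewrite eigenvalue_root_char sE cpm scale1r root_prod_XsubC.
pose E := [set x : R | eigenvalue A x%:C].
have E0 : E (complex.Re z0) by rewrite /E /= -Areal.
have [x Ex xmin] : exists2 x, E x & forall y, E y -> x <= y.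
  have Emin (t : seq R[i]) : {subset t <= s} -> t != [::] ->
      exists2 x, E x & forall z, z \in t -> x <= complex.Re z.
    elim: t => // z t IH ts _; have Ez : E (complex.Re z).
      have Az : eigenvalue A z by rewrite Es ts ?mem_head.
      by rewrite /E /= -Areal.
    have [t0|tn0] := eqVneq t [::].
      by exists (complex.Re z) => // y; rewrite t0 inE => /eqP ->.
    have [y ty|x Ex xt] := IH _ tn0; first by rewrite ts ?inE ?ty ?orbT.
    have [zx|xz] := leP (complex.Re z) x.
      exists (complex.Re z) => // y; rewrite inE => /predU1P[->//|/xt].
      exact: le_trans.
    by exists x => // y; rewrite inE => /predU1P[->|/xt//]; exact: ltW.
  have [//||x Ex xs] := Emin s; first by move: Az0; rewrite Es; case: (s).
  by exists x => // y; rewrite /E /= Es => /xs.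
have -> : lambda1 A = x.
  apply/eqP; rewrite eq_le; apply/andP; split.
    by apply: (@ge_inf _ E) => //; exists x.
  by apply: (@lb_le_inf _ E); [exists (complex.Re z0) | exact: xmin].
split=> // z Az; have zE := Areal z Az; rewrite zE lecR.
by apply: xmin; rewrite /E /= -zE.
Qed.

End Gabor.

(* Main.v *)
(* (2) G_n is positive semidefinite and contains G_n^[0] as a principal submatrix,
   so by Cauchy interlacing 0 <= lambda_1(G_n) <= lambda_1(G_n^[0]).

   (1) By contraposition. The N-th distributional derivative of s_N is a
   combination of Dirac masses at the knots j - N/2, 0 <= j <= N, so integrating
   s_N against the N-th derivative of a bump f samples the N-th central
   difference of f. If a is irrational, the integers 1, ..., N stay away from
   the lattice aZ; a bump f with small enough support then sees a single knot of
   a single translate s_N(. - ka), and its N-th derivative generates functions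
   biorthogonal to these translates, with disjoint supports. Hence
   c sum |p_k|^2 <= |sum p_k s_N(. - ka)|^2 with c > 0 independent of n, i.e.
   lambda_1(G_n^[0]) >= c. *)
Require Import Defs.
From mathcomp Require Import all_boot all_order all_algebra.
From mathcomp Require Import all_classical all_reals all_analysis.
From mathcomp Require Import measurable_realfun complex spectral sesquilinear.
From mathcomp Require Import ring lra.

Import Order.TTheory GRing.Theory Num.Theory.
Import numFieldNormedType.Exports.

Local Open Scope classical_set_scope.
Local Open Scope ring_scope.
Local Open Scope sesquilinear_scope.

(** * Bounded functions with compact support *)

Section Integrals.
Context {R : realType}.
Local Notation mu := (@lebesgue_measure R).
Implicit Types f h : R -> R.

(** A single [K] serves both as bound and as support radius, and evaluating at any point forces
    [0 <= K]. The class is closed under sums, products, shifts and convolution with the box, and it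
    supplies integrability throughout. *)
Definition bcsupp (f : R -> R) : Prop :=
  measurable_fun setT f /\
  exists K : R, forall x, `|f x| <= K /\ (K < `|x| -> f x = 0).

Lemma bounded_support_integrable d (T : measurableType d)
    (m : {measure set T -> \bar R}) (A : set T) (f : T -> R) (K : R) :
  measurable A -> (m A < +oo)%E -> measurable_fun setT f ->
  (forall x, `|f x| <= K) -> (forall x, ~ A x -> f x = 0) ->
  m.-integrable setT (EFin \o f).
Proof.
move=> mA Afin mf fK f0.
have -> : EFin \o f = (EFin \o f) \_ A.
  apply/funext => x; rewrite patchE; case: ifPn => //.
  by rewrite notin_setE => /f0 /= ->.
apply/(integrable_mkcond _ mA)/measurable_bounded_integrable => //.
- exact: measurable_funTS.
- exists K; split; first exact: num_real.
  by move=> M KM x _ /=; rewrite (le_trans (fK x))// ltW.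
Qed.

Lemma bcsupp_integrable f : bcsupp f -> mu.-integrable setT (EFin \o f).
Proof.
move=> [mf [K fK]].
apply: (@bounded_support_integrable _ _ mu `[- K, K]%classic f K) => //.
- by rewrite [X in (X < _)%E]lebesgue_measure_itv/=; case: ifP => _; rewrite ?ltry.
- by move=> x; have [] := fK x.
- move=> x xK; have [_ ->//] := fK x.
  by rewrite ltNge ler_norml; apply/negP => h; apply: xK; rewrite /= in_itv.
Qed.

Lemma bcsuppD f h : bcsupp f -> bcsupp h -> bcsupp (fun x => f x + h x).
Proof.
move=> [mf [K fK]] [mh [L hL]]; split; first exact: measurable_funD.
have K0 : 0 <= K by have [f0 _] := fK 0; exact: le_trans (normr_ge0 _) f0.
have L0 : 0 <= L by have [h0 _] := hL 0; exact: le_trans (normr_ge0 _) h0.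
exists (K + L) => x; have [a b] := fK x; have [c d] := hL x; split.
  by rewrite (le_trans (ler_normD _ _))// lerD.
by move=> KLx; rewrite b ?d ?addr0//; lra.
Qed.

Lemma bcsuppMr f h (C : R) : bcsupp f -> measurable_fun setT h ->
  (forall x, `|h x| <= C) -> bcsupp (fun x => f x * h x).
Proof.
move=> [mf [K fK]] mh hC; split; first exact: measurable_funM.
have K0 : 0 <= K by have [f0 _] := fK 0; exact: le_trans (normr_ge0 _) f0.
have C0 : 0 <= C by exact: le_trans (normr_ge0 _) (hC 0).
exists (K * C + K) => x; have [a b] := fK x; split.
  rewrite normrM (@le_trans _ _ (K * C))//; first exact: ler_pM.
  by rewrite lerDl.
move=> Kx; rewrite b ?mul0r//; apply: le_lt_trans Kx.
by rewrite lerDr mulr_ge0.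
Qed.

Lemma bcsuppM f h : bcsupp f -> bcsupp h -> bcsupp (fun x => f x * h x).
Proof.
by move=> nf [mh [L hL]]; apply: (bcsuppMr _ _ L) => // x; have [] := hL x.
Qed.

Lemma bcsuppZ (r : R) f : bcsupp f -> bcsupp (fun x => r * f x).
Proof.
move=> nf; have -> : (fun x => r * f x) = (fun x => f x * r).
  by apply/funext => x; rewrite mulrC.
by apply: (bcsuppMr _ _ `|r|).
Qed.

Lemma bcsupp_cst0 : bcsupp (fun=> 0).
Proof. by split=> //; exists 0 => x; rewrite normr0. Qed.

Lemma bcsupp_sum (I : Type) (s : seq I) (F : I -> R -> R) :
  (forall i, bcsupp (F i)) -> bcsupp (fun x => \sum_(i <- s) F i x).
Proof.
move=> nF; elim: s => [|i s IH].
  by under eq_fun do rewrite big_nil; exact: bcsupp_cst0.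
by under eq_fun do rewrite big_cons; exact: bcsuppD.
Qed.

Lemma measurable_shift (c : R) : measurable_fun setT (fun x : R => x + c).
Proof. exact: measurable_funD. Qed.

Lemma bcsupp_shift f c : bcsupp f -> bcsupp (fun x => f (x + c)).
Proof.
move=> [mf [K fK]]; split.
  by apply: (measurableT_comp mf); exact: measurable_shift.
exists (K + `|c|) => x; have [a b] := fK (x + c); split.
  by rewrite (le_trans a)// lerDl.
move=> h; rewrite b//; have := lerB_normD x c; lra.
Qed.

Lemma Rintegral_sum (I : Type) (s : seq I) (F : I -> R -> R) :
  (forall i, bcsupp (F i)) ->
  (\int[mu]_x (\sum_(i <- s) F i x))%R = \sum_(i <- s) (\int[mu]_x F i x)%R.
Proof.
move=> nF; elim: s => [|i s IH].
  rewrite big_nil; under eq_Rintegral do rewrite big_nil.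
  by rewrite /Rintegral integral0.
rewrite big_cons; under eq_Rintegral do rewrite big_cons.
rewrite RintegralD ?IH//; apply: bcsupp_integrable => //; exact: bcsupp_sum.
Qed.

(** The pushforward has the right value on half-open intervals, which characterises Lebesgue
    measure. *)
Lemma pushforward_shift (c : R) (A : set R) : measurable A ->
  pushforward mu (fun x : R => (x + c)%R : measurableTypeR R) A = mu A.
Proof.
move=> mA; apply/esym/lebesgue_measure_unique => //=.
  exact: measurable_shift.
move=> ? _ [[a b]] _ <-.
rewrite /pushforward (_ : _ @^-1` _ = `]a - c, b - c]%classic); last first.
  by apply/seteqP; split => x /=; rewrite !in_itv/= ltrBlDr lerBrDr.
rewrite !lebesgue_measure_itv/= !lte_fin ltrD2r.
by case: ifP => // _; rewrite -!EFinB; congr (_%:E); ring.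
Qed.

Lemma Rintegral_shift f (c : R) : bcsupp f ->
  (\int[mu]_x f (x + c))%R = (\int[mu]_x f x)%R.
Proof.
move=> nf; congr fine.
have mf : measurable_fun [set: measurableTypeR R] (EFin \o f).
  by apply/measurable_EFinP; case: nf.
rewrite -[LHS](@integral_pushforward _ _ (measurableTypeR R) (measurableTypeR R) R
  (fun x => x + c) (measurable_shift c) mu setT
  (EFin \o f) mf _ measurableT); last first.
  exact: (bcsupp_integrable _ (bcsupp_shift _ c nf)).
apply: eq_measure_integral => /=; first exact: measurable_shift.
by move=> mp A mA _; rewrite -(pushforward_shift c A mA).
Qed.

End Integrals.

(** * Convolution with the box *)

Section Convolution.
Context {R : realType}.
Local Notation mu := (@lebesgue_measure R).
Implicit Types f w : R -> R.

Lemma bcsupp_box : bcsupp (@box R).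
Proof.
split; first exact/measurable_indicP.
exists 1 => x; rewrite /box indicE; split.
  by case: (_ \in _); rewrite ?normr1 ?normr0.
move=> x1; rewrite memNset//= in_itv/= => /andP[h1 h2].
have := ler_norml x (1 / 2); rewrite h2 andbT => e.
have : `|x| <= 1 / 2 by rewrite e; lra.
lra.
Qed.

(** Where [box t] and [f (x - t)] are both nonzero, [t] and [x - t] are bounded, so the kernel lives
    on a square of finite measure. The weight [w = 1] yields measurability of the convolution; a
    compactly supported [w] yields the duality formula. *)
Lemma box_kernel_integrable f w (C : R) : bcsupp f -> measurable_fun setT w ->
  (forall x, `|w x| <= C) ->
  (mu \x mu)%E.-integrable setT
    (fun z : R * R => (box z.2 * f (z.1 - z.2) * w z.1)%:E).
Proof.
move=> [mf [K fK]] mw wC; have [mb [L bL]] := bcsupp_box.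
have K0 : 0 <= K by have [f0 _] := fK 0; exact: le_trans (normr_ge0 _) f0.
have L0 : 0 <= L by have [f0 _] := bL 0; exact: le_trans (normr_ge0 _) f0.
have C0 : 0 <= C by exact: le_trans (normr_ge0 _) (wC 0).
pose I := `[- (K + L), K + L]%classic : set R.
apply: (@bounded_support_integrable R _ _ (mu \x mu)%E (I `*` I)
  (fun z : R * R => box z.2 * f (z.1 - z.2) * w z.1) (L * K * C)).
- by apply: measurableX; exact: measurable_itv.
- rewrite [X in (X < _)%E]product_measure1E; try exact: measurable_itv.
  rewrite [X in (X * X)%E]lebesgue_measure_itv/=; case: ifP => _.
    by rewrite -EFinB -EFinM ltry.
  by rewrite mule0 ltry.
- apply: measurable_funM; first apply: measurable_funM.
  + exact: (measurableT_comp mb measurable_snd).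
  + apply: (measurableT_comp mf); apply: measurable_funB.
      exact: measurable_fst.
    exact: measurable_snd.
  + exact: (measurableT_comp mw measurable_fst).
- move=> -[x t] /=; rewrite !normrM.
  have [a _] := bL t; have [b _] := fK (x - t).
  by rewrite !ler_pM ?mulr_ge0.
move=> -[x t] xt /=.
have [_ a] := bL t; have [_ b] := fK (x - t).
have [/a->|tL] := ltP L `|t|; first by rewrite !mul0r.
have [/b->|xK] := ltP K `|x - t|; first by rewrite mulr0 mul0r.
exfalso; apply: xt; rewrite /I /= !in_itv/= -!ler_norml; split.
  by have := ler_normD (x - t) t; rewrite subrK; lra.
by lra.
Qed.

Lemma bcsupp_box_kernel f x : bcsupp f -> bcsupp (fun t => box t * f (x - t)).
Proof.
move=> [mf [K fK]]; apply: (bcsuppMr _ _ K) => //; first exact: bcsupp_box.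
  by apply: (measurableT_comp mf); exact: measurable_funB.
by move=> t; have [] := fK (x - t).
Qed.

Lemma bcsupp_convolution f : bcsupp f -> bcsupp (convolution box f).
Proof.
move=> nf; split.
  have C1 (x : R) : `|cst (1 : R) x| <= 1 by rewrite /= normr1.
  have /measurable_fubini_F h :=
    box_kernel_integrable f _ _ nf (measurable_cst (1 : R)) C1.
  have {}h := measurableT_comp (fine_measurable measurableT) h.
  apply: eq_measurable_fun h => x _.
  rewrite /= /convolution /Rintegral /fubini_F; congr fine.
  by apply: eq_integral => t _; rewrite /= mulr1.
have [_ [K fK]] := nf.
have K0 : 0 <= K by have [f0 _] := fK 0; exact: le_trans (normr_ge0 _) f0.
have b0 (t : R) : box t != 0 -> `|t| <= 1 / 2.
  rewrite /box indicE ler_norml; case: (boolP (t \in _)) => [|_].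
    by rewrite inE /= in_itv/=; move=> /andP[h1 h2] _; apply/andP; split; lra.
  by rewrite eqxx.
(* The box has mass 1, so the bound [K] persists; the support radius grows by 1/2, which is less
   than 1. *)
exists (K + 1) => x; split.
  rewrite (@le_trans _ _ (\int[mu]_t (K * box t))%R)//.
    rewrite (le_trans (le_normr_Rintegral _ _))//.
      by apply: bcsupp_integrable; exact: bcsupp_box_kernel.
    apply: le_Rintegral => //.
    - apply: bcsupp_integrable; have [mk [L kL]] := bcsupp_box_kernel _ x nf.
      split; first exact: measurableT_comp.
      by exists L => t; have [h1 h2] := kL t; rewrite normr_id; split=> // /h2 ->; rewrite normr0.
    - by apply: bcsupp_integrable; apply: bcsuppZ; exact: bcsupp_box.
    move=> t _; have [a _] := fK (x - t).
    rewrite normrM mulrC [`|box t|]ger0_norm; last by rewrite /box indicE.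
    by rewrite ler_wpM2r// /box indicE.
  rewrite RintegralZl//; last by apply: bcsupp_integrable; exact: bcsupp_box.
  rewrite (_ : \int[mu]_t _ = 1); first by rewrite mulr1 lerDl.
  rewrite /Rintegral /box integral_indic//= setIT lebesgue_measure_itv/= lte_fin.
  by rewrite ifT ?fineB//=; lra.
move=> Kx; rewrite /convolution /Rintegral integral0_eq// => t _ /=.
congr (_%:E).
have [->|/b0 ht] := eqVneq (box t) 0; first by rewrite mul0r.
have [_ ->] := fK (x - t); first by rewrite mulr0.
by have := lerB_dist x t; lra.
Qed.

(** Fubini and the substitution of [x + t] for [x]: convolving [f] with the box averages the pairing
    over shifts of [w]. This peels one box off a B-spline. *)
Lemma pair_convolution f w : bcsupp f -> bcsupp w ->
  (\int[mu]_x (convolution box f x * w x))%R =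
  (\int[mu]_t (box t * (\int[mu]_x (f x * w (x + t)))%R))%R.
Proof.
move=> nf nw; have [mw [C wC]] := nw.
have /Fubini F := box_kernel_integrable f w C nf mw (fun x => (wC x).1).
have mshift t : bcsupp (fun x => f (x - t) * w x).
  by apply: bcsuppM => //; exact: bcsupp_shift.
transitivity (fine (\int[mu]_x \int[mu]_t (box t * f (x - t) * w x)%:E)).
  congr fine; apply: eq_integral => x _; rewrite /convolution -RintegralZr//; last first.
    by apply: bcsupp_integrable; exact: bcsupp_box_kernel.
  rewrite fineK//; apply: integrable_fin_num => //; apply: bcsupp_integrable.
  apply: (bcsuppMr _ _ `|w x|) => //; exact: bcsupp_box_kernel.
rewrite F; congr fine; apply: eq_integral => t _ /=.
have nk : bcsupp (fun x => box t * (f (x - t) * w x)) by exact: bcsuppZ.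
under eq_integral do rewrite -mulrA.
rewrite -[LHS]fineK; last first.
  by apply: integrable_fin_num => //; exact: bcsupp_integrable.
congr (_%:E); rewrite -/(Rintegral _ _ _) RintegralZl//; last exact: bcsupp_integrable.
congr (_ * _); rewrite -(Rintegral_shift _ t)//.
by apply: eq_Rintegral => x _; rewrite addrK.
Qed.

End Convolution.

(** * Pairing B-splines with smooth bumps *)

Section Bump.
Context {R : realType}.
Local Notation mu := (@lebesgue_measure R).
Implicit Types f w : R -> R.

(** Integrating a derivative over [[y - 1/2, y + 1/2]] gives this difference, so each box factor
    trades one derivative for one [cdiff]. *)
Definition cdiff (f : R -> R) (y : R) : R := f (y + 1 / 2) - f (y - 1 / 2).

(** The iterated central difference is an alternating binomial combination of the values at
    [y + N/2 - j], [0 <= j <= N], and the node [j = 0] has coefficient 1. *)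
Lemma iter_cdiff_isolated N f y :
  (forall j, (1 <= j <= N)%N -> f (y + N%:R / 2 - j%:R) = 0) ->
  iter N cdiff f y = f (y + N%:R / 2).
Proof.
elim: N y => [|N IH] y f0; first by rewrite /= mul0r addr0.
have nS (m : nat) : m.+1%:R = m%:R + 1 :> R by rewrite -addn1 natrD.
rewrite iterS /cdiff !IH.
- have := f0 1 isT; rewrite nS => f1.
  rewrite [X in _ - f X](_ : _ = y + (N%:R + 1) / 2 - 1%:R) ?f1 ?subr0; last by field.
  by congr f; rewrite nS; field.
- move=> j /andP[j1 jN]; rewrite -(f0 j.+1) ?nS ?ltnS ?jN//.
  by congr f; field.
- move=> j /andP[j1 jN]; rewrite -(f0 j) ?j1 ?(leq_trans jN)//.
  by congr f; rewrite nS; field.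
Qed.

Lemma is_derive_shiftr f (x c d : R) :
  is_derive (x + c) 1 f d -> is_derive x 1 (fun t => f (t + c)) d.
Proof.
move=> fd.
have h : is_derive x 1 (fun t : R => t + c) 1.
  by apply: is_derive_eq; rewrite addr0.
by have := @is_derive1_comp R f (fun t : R => t + c) x d 1 fd h; rewrite mulr1.
Qed.

Lemma is_derive_iter_cdiff N f w :
  (forall x : R, is_derive x 1 f (w x)) ->
  forall x : R, is_derive x 1 (iter N cdiff f) (iter N cdiff w x).
Proof.
move=> fw; elim: N => [//|N IH] x; rewrite !iterS.
by apply: is_deriveB; apply: is_derive_shiftr; exact: IH.
Qed.

Lemma is_derive_continuous f w :
  (forall x : R, is_derive x 1 f (w x)) -> continuous f.
Proof.
move=> fw x; apply/differentiable_continuous/derivable1_diffP.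
by have [] := fw x.
Qed.

Lemma integral_box_derive f w (y : R) :
  (forall x : R, is_derive x 1 f (w x)) -> continuous w ->
  (\int[mu]_t (box t * w (t + y)))%R = cdiff f y.
Proof.
move=> fw cw.
have E : (\int[mu]_t (box t * w (t + y)))%R =
    (\int[mu]_(t in `[- (1 / 2), 1 / 2]) w (t + y))%R.
  rewrite [RHS]Rintegral_mkcond; apply: eq_Rintegral => t _.
  by rewrite patchE /box indicE; case: (t \in _); rewrite ?mul1r ?mul0r.
have shw (x : R) : is_derive x 1 (fun t => f (t + y)) (w (x + y)).
  exact: is_derive_shiftr.
rewrite E /Rintegral (@continuous_FTC2 _ _ (fun t => f (t + y))).
- by rewrite /= /cdiff; congr (f _ - f _); ring.
- by lra.
- apply: continuous_subspaceT => x.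
  apply: (@continuous_comp R R R (fun t => t + y) w x); last exact: cw.
  by apply: cvgD; [exact: cvg_id | exact: cvg_cst].
- have c := is_derive_continuous _ _ shw.
  split.
  + by move=> x _; have [] := shw x.
  + by apply: cvg_at_right_filter; exact: c.
  + by apply: cvg_at_left_filter; exact: c.
- by move=> x _; rewrite derive1E; have [_ ->] := shw x.
Qed.

(** The truncated power, of smoothness [p - 1] for [p >= 1]; for [p = 0] it is the constant 1, so
    factors meant to vanish carry a positive exponent. *)
Definition tpow (p : nat) (x : R) : R := Num.max x 0 ^+ p.

Lemma continuous_tpow p : continuous (tpow p).
Proof.
move=> x; apply: (@continuous_comp R R R (fun x : R => Num.max x 0) (fun x => x ^+ p) x).
  by apply: (@continuous_max _ _ id (cst 0)); [exact: cvg_id | exact: cvg_cst].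
exact: exprn_continuous.
Qed.

Lemma is_derive_tpow p (x : R) :
  is_derive x 1 (tpow p.+2) (p.+2%:R * tpow p.+1 x).
Proof.
have [x0|x0|->] := ltgtP x 0.
- rewrite /tpow max_r ?ltW// expr0n /= mulr0.
  apply: (@near_eq_is_derive _ _ _ (cst 0)).
  near=> z; rewrite /tpow max_r ?expr0n//; apply/ltW; near: z.
  exact: lt_nbhsl.
- rewrite /tpow max_l ?ltW//.
  apply: (@near_eq_is_derive _ _ _ (fun z : R => z ^+ p.+2)).
    near=> z; rewrite /tpow max_l//; apply/ltW; near: z.
    exact: lt_nbhsr.
  have := is_deriveX p.+2 (is_derive_id x (1 : R)).
  rewrite exprfctE => h; apply: is_derive_eq h _.
  by rewrite /GRing.scale /= mulr1.
(* At the origin the difference quotient equals [tpow p.+1 h] for [h != 0], so its limit follows by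
   continuity. *)
- have E : (fun h : R => h^-1 *: ((tpow p.+2 \o shift 0) (h *: 1) - tpow p.+2 0))
      @ 0^' --> (p.+2%:R * tpow p.+1 0 : R).
    have -> : p.+2%:R * tpow p.+1 0 = tpow p.+1 0.
      by rewrite /tpow maxxx expr0n /= mulr0.
    have : tpow p.+1 h @[h --> 0^'] --> tpow p.+1 0.
      by apply: cvg_within_filter; exact: continuous_tpow.
    apply: cvg_trans; apply: near_eq_cvg; near=> h.
    have h0 : h != 0 by near: h; exact: nbhs_dnbhs_neq.
    rewrite /tpow /= maxxx addr0 expr0n subr0 /GRing.scale /= mulr1.
    have [hlt|hge] := ltP h 0; first by rewrite !expr0n /= mulr0.
    by rewrite [in RHS]exprS mulKf.
  split; first by apply/cvg_ex; exists (p.+2%:R * tpow p.+1 0).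
  exact: cvg_lim E.
Unshelve. all: by end_near.
Qed.

(* Only the [n]-th derivative of [f] is required to vanish outside [(-e, e)]. *)
Fixpoint bump (e : R) (n : nat) (f : R -> R) : Prop :=
  match n with
  | 0 => continuous f /\ (forall x, e <= `|x| -> f x = 0)
  | m.+1 => exists f', (forall x : R, is_derive x 1 f (f' x)) /\ bump e m f'
  end.

Lemma bump_continuous e n f : bump e n f -> continuous f.
Proof. by case: n => [[]//|n [w [/is_derive_continuous]]]. Qed.

Lemma bump_lin e n (r s : R) f h : bump e n f -> bump e n h ->
  bump e n (fun x => r * f x + s * h x).
Proof.
elim: n f h => [|n IH] f h /=.
  move=> [cf f0] [ch h0]; split=> [x|x ex]; last by rewrite f0// h0// !mulr0 addr0.
  by apply: cvgD; apply: cvgM => //; [exact: cvg_cst|exact: cf|exact: cvg_cst|exact: ch].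
move=> [f' [df bf]] [h' [dh bh]]; exists (fun x => r * f' x + s * h' x).
split; last exact: IH.
by move=> x; apply: is_deriveD; apply: is_deriveZ.
Qed.

(** Two independent exponents, because each term of the product rule lowers only one of them. *)
Definition tbump (e : R) (p q : nat) (x : R) : R := tpow p (x + e) * tpow q (e - x).

Lemma is_derive_tbump e p q (x : R) : is_derive x 1 (tbump e p.+2 q.+2)
  (p.+2%:R * tbump e p.+1 q.+2 x + - q.+2%:R * tbump e p.+2 q.+1 x).
Proof.
have h1 : is_derive x 1 (fun t => tpow p.+2 (t + e)) (p.+2%:R * tpow p.+1 (x + e)).
  by apply: is_derive_shiftr; exact: is_derive_tpow.
have h2 : is_derive x 1 (fun t => tpow q.+2 (e - t)) (- (q.+2%:R * tpow q.+1 (e - x))).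
  have h : is_derive x 1 (fun t : R => e - t) (-1).
    have := is_deriveB (is_derive_cst e x (1 : R)) (is_derive_id x (1 : R)).
    by rewrite sub0r.
  have := @is_derive1_comp R (tpow q.+2) (fun t : R => e - t) x _ _ (is_derive_tpow q (e - x)) h.
  by rewrite mulrN1.
apply: is_derive_eq (is_deriveM h1 h2) _.
by rewrite /tbump /GRing.scale /=; ring.
Qed.

Lemma tbump_outside e p q (x : R) : e <= `|x| -> tbump e p.+1 q.+1 x = 0.
Proof.
rewrite /tbump /tpow; have [x0|x0] := ltP x 0.
  by rewrite ltr0_norm// => ex; rewrite [X in X ^+ p.+1]max_r ?expr0n ?mul0r//; lra.
by rewrite ger0_norm// => ex; rewrite [X in X ^+ q.+1]max_r ?expr0n ?mulr0//; lra.
Qed.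

(** Each term of the derivative loses one power in one factor, so the induction on [n] runs over all
    [p] and [q] at once. *)
Lemma bump_tbump e n p q : (n <= p)%N -> (n <= q)%N -> bump e n (tbump e p.+1 q.+1).
Proof.
elim: n p q => [|n IH] p q.
  move=> _ _; split.
    move=> x; apply: cvgM.
      apply: (@continuous_comp R R R (fun t => t + e) (tpow p.+1) x); last exact: continuous_tpow.
      by apply: cvgD; [exact: cvg_id | exact: cvg_cst].
    apply: (@continuous_comp R R R (fun t => e - t) (tpow q.+1) x); last exact: continuous_tpow.
    by apply: cvgB; [exact: cvg_cst | exact: cvg_id].
  exact: tbump_outside.
case: p q => [//|p] [//|q]; rewrite !ltnS => np nq.
exists (fun x => p.+2%:R * tbump e p.+1 q.+2 x + - q.+2%:R * tbump e p.+2 q.+1 x).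
split; first exact: is_derive_tbump.
by apply: bump_lin; apply: IH => //; exact: leqW.
Qed.

Lemma exists_bump e n : 0 < e -> exists f,
  [/\ bump e n f, f 0 = 1 & forall x, e <= `|x| -> f x = 0].
Proof.
move=> e0; pose c := tbump e n.+1 n.+1 0.
have c0 : c != 0.
  by rewrite /c /tbump /tpow add0r subr0 max_l ?ltW// mulf_neq0// expf_neq0// gt_eqF.
(* Normalised to take the value 1 at 0; the zero term gives the shape that [bump_lin] expects. *)
exists (fun x => c^-1 * tbump e n.+1 n.+1 x + 0 * tbump e n.+1 n.+1 x); split.
  by apply: bump_lin; exact: bump_tbump.
by rewrite mul0r addr0 mulVf.
by move=> x ex; rewrite tbump_outside// !mulr0 addr0.
Qed.

Lemma bump_bcsupp e f : bump e 0 f -> bcsupp f.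
Proof.
move=> [cf f0]; split; first exact: continuous_measurable_fun.
have [c _ cmax] : exists2 c, c \in `[- `|e|, `|e|]%R &
    forall t, t \in `[- `|e|, `|e|]%R -> `|f t| <= `|f c|.
  apply: (@EVT_max R (fun x => `|f x|)); first by have := normr_ge0 e; lra.
  by apply: continuous_subspaceT => x; apply: cvg_norm; exact: cf.
exists (`|f c| + `|e|) => x; split; last first.
  move=> h; apply: f0; apply: le_trans (ltW h).
  by rewrite (le_trans (ler_norm _))// lerDr.
have [/ltW xe|xe] := ltP e `|x|; first by rewrite f0// normr0 addr_ge0.
rewrite (@le_trans _ _ `|f c|) ?lerDl// cmax// in_itv/= -ler_norml.
exact: le_trans (ler_norm _).
Qed.

End Bump.

(** * B-splines paired with high derivatives of bumps *)

Section Bspline.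
Context {R : realType}.
Local Notation mu := (@lebesgue_measure R).

Lemma bcsupp_bspline N : bcsupp (@bspline R N).
Proof.
rewrite /bspline; elim: N.-1 => [|n IH]; first exact: bcsupp_box.
by rewrite iterS; exact: bcsupp_convolution.
Qed.

(* [w] is the [N.+1]-st derivative of [f]. *)
Lemma pair_bspline_bump (e : R) N f : bump e N.+1 f ->
  exists w, [/\ bcsupp w, forall x, e <= `|x| -> w x = 0 &
    forall y, (\int[mu]_x (bspline N.+1 x * w (x + y)))%R = iter N.+1 cdiff f y].
Proof.
elim: N f => [|N IH] f.
  move=> [w [fw bw]]; exists w; split; [exact: bump_bcsupp _ _ bw|by case: bw|].
  by move=> y; apply: (integral_box_derive _ _ _ fw); exact: (bump_continuous e 0 w bw).
move=> [f' [ff' bf']]; have [w [nw w0 wE]] := IH _ bf'.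
exists w; split=> // y.
(* Peeling off one box leaves an inner pairing that the induction hypothesis evaluates as a central
   difference of [f'] at [t + y]. *)
rewrite (pair_convolution (bspline N.+1) (fun x => w (x + y))); last 2 first.
- exact: bcsupp_bspline.
- exact: bcsupp_shift.
(* Central differences commute with differentiation, so the remaining box integral is that of a
   derivative and adds one more [cdiff]. *)
have dN := is_derive_iter_cdiff N.+1 _ _ ff'.
rewrite iterS -(integral_box_derive _ _ y dN).
  apply: eq_Rintegral => t _; congr (_ * _); rewrite -wE.
  by apply: eq_Rintegral => x _; rewrite addrA.
(* The order of the bump leaves [f'] differentiable, which gives the continuity required by the
   fundamental theorem of calculus. *)
have [f'' [df' _]] := bf'.
by apply: is_derive_continuous (is_derive_iter_cdiff _ _ _ df').
Qed.

End Bspline.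

(** * Stability of translates for an irrational step *)

Section Riesz.
Context {R : realType}.
Local Notation mu := (@lebesgue_measure R).

Lemma Rintegral_bilinear (I J : Type) (r : seq I) (s : seq J)
    (u : I -> R -> R) (v : J -> R -> R) (p : I -> R) (q : J -> R) :
  (forall i, bcsupp (u i)) -> (forall j, bcsupp (v j)) ->
  (\int[mu]_x ((\sum_(i <- r) p i * u i x) * (\sum_(j <- s) q j * v j x)))%R =
  \sum_(i <- r) \sum_(j <- s) p i * q j * (\int[mu]_x (u i x * v j x))%R.
Proof.
move=> nu nv; have nuv i j : bcsupp (fun x => u i x * v j x) by exact: bcsuppM.
have nz i j : bcsupp (fun x => p i * q j * (u i x * v j x)) by exact: bcsuppZ.
under eq_Rintegral do rewrite mulr_suml.
under eq_Rintegral do under eq_bigr do rewrite mulr_sumr.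
have E i : (fun x => \sum_(j <- s) p i * u i x * (q j * v j x)) =
    (fun x => \sum_(j <- s) (p i * q j * (u i x * v j x))).
  by apply/funext => x; apply: eq_bigr => j _; rewrite mulrACA.
rewrite Rintegral_sum; last by move=> i; rewrite E; exact: bcsupp_sum.
apply: eq_bigr => i _; rewrite E Rintegral_sum//.
by apply: eq_bigr => j _; rewrite RintegralZl//; exact: bcsupp_integrable.
Qed.

(** No positive integer lies on the lattice of multiples of an irrational [a], and finitely many
    positive distances have a positive minimum. The bound [2 * e <= a] later keeps bumps at distinct
    lattice points disjoint. *)
Lemma separation (a : R) (N : nat) : 0 < a -> ~ (exists q : rat, a = ratr q) ->
  exists e : R, [/\ 0 < e, 2 * e <= a & forall (m : int) (j : nat),
    (1 <= j <= N)%N -> e <= `|m%:~R * a - j%:R|].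
Proof.
move=> a0 irr; elim: N => [|N [e [e0 ea IH]]].
  by exists (a / 2); split=> [||m [|j]//]; lra.
(* The lattice neighbours of the new integer [x] are [m0 * a] and [(m0 + 1) * a]; every other
   lattice point is at least as far away. *)
pose x : R := N.+1%:R; pose m0 := Num.floor (x / a).
have lo : m0%:~R * a <= x by rewrite -ler_pdivlMr// Num.Theory.floor_le.
have hi : x < (m0 + 1)%:~R * a by rewrite -ltr_pdivrMr// Num.Theory.floorD1_gt.
have neq : m0%:~R * a != x.
  apply/eqP => xE; apply: irr; exists (N.+1%:R / m0%:~R).
  have m00 : m0%:~R != 0 :> R.
    by apply: contraPneq xE => ->; rewrite mul0r /x; apply/eqP; rewrite eq_sym pnatr_eq0.
  by rewrite fmorph_div rmorph_nat rmorph_int -[N.+1%:R]/x -xE mulrC mulKf.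
exists (Num.min e (Num.min (x - m0%:~R * a) ((m0 + 1)%:~R * a - x))); split.
- by rewrite !lt_min e0 !subr_gt0 hi lt_neqAle neq lo.
- by apply: le_trans ea; rewrite ler_pM2l// ge_min lexx.
move=> m j /andP[j1]; rewrite leq_eqVlt => /predU1P[->|jN]; last first.
  by rewrite ge_min IH// j1.
rewrite -/x !ge_min; have [mm|mm] := leP m m0.
  have mm' : m%:~R * a <= m0%:~R * a by rewrite ler_pM2r// ler_int.
  rewrite ler0_norm; last by rewrite subr_le0 (le_trans mm').
  by rewrite opprB lerD2l lerN2 mm' !orbT.
have mm' : (m0 + 1)%:~R * a <= m%:~R * a by rewrite ler_pM2r// ler_int lezD1.
rewrite ger0_norm; last by rewrite subr_ge0 ltW// (lt_le_trans hi).
by rewrite lerD2r mm' !orbT.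
Qed.

(** The centring offset cancels, so differences of indices are integers for either parity of [n]. *)
Lemma idxB (n : nat) (i j : 'I_n) :
  @idx R n i - idx j = ((i : nat)%:Z - (j : nat)%:Z)%:~R.
Proof. by rewrite /idx intrB; lra. Qed.

(* Expand [0 <= \int (F - t H)^2], where [H] combines the dual functions [h k]
   with the same coefficients as [F] combines the translates of the B-spline. *)
Lemma riesz_lower_bound (a : R) (N : nat) :
  0 < a -> ~ (exists q : rat, a = ratr q) -> exists c : R, 0 < c /\
  forall (n : nat) (p : 'I_n -> R),
    c * (\sum_i p i ^+ 2) <=
    (\int[mu]_x ((\sum_i p i * bspline N.+1 (x - idx i * a)) ^+ 2))%R.
Proof.
move=> a0 irr; have [e [e0 ea sep]] := separation a N.+1 a0 irr.
have [f [bf f1 f0]] := exists_bump e N.+1 e0.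
have [w [nw w0 wE]] := pair_bspline_bump e N f bf.
pose B := (\int[mu]_x (w x * w x))%R.
have B0 : 0 <= B by apply: Rintegral_ge0 => x _; rewrite -expr2 sqr_ge0.
(* [B] is the squared norm of a dual function; adding 1 makes the denominator positive from [0 <= B]
   alone. *)
exists (B + 1)^-1; split; first by rewrite invr_gt0; lra.
move=> n p; pose t := (B + 1)^-1.
pose g (k : 'I_n) x := @bspline R N.+1 (x - idx k * a).
(* The dual function is centred at the rightmost knot of [g k]. *)
pose h (k : 'I_n) x := w (x - (idx k * a + N.+1%:R / 2)).
have ng k : bcsupp (g k) by apply: bcsupp_shift; exact: bcsupp_bspline.
have nh k : bcsupp (h k) by exact: bcsupp_shift.
have idx_far (k m : 'I_n) : k != m -> a <= `|(idx k - idx m) * a|.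
  move=> km; rewrite normrM [X in _ <= _ * X]gtr0_norm// -[X in X <= _]mul1r ler_pM2r//.
  rewrite idxB -intr_norm -[1]/(1%:~R) ler_int -gtz0_ge1 normr_gt0 subr_eq0.
  by apply: contraNneq km => -[] /ord_inj ->.
(* Biorthogonality: the pairing samples [f] at [(idx k - idx m) * a - j] for [0 <= j <= N + 1].
   Separation kills every [j >= 1], and the node [j = 0] gives [f 0 = 1] if [k = m] and 0
   otherwise. *)
have gh k m : (\int[mu]_x (g k x * h m x))%R = (k == m)%:R.
  have nk : bcsupp (fun x => g k x * h m x) by exact: bcsuppM.
  rewrite -(Rintegral_shift _ (idx k * a) nk) /g /h.
  transitivity (\int[mu]_x (bspline N.+1 x * w (x + ((idx k - idx m) * a - N.+1%:R / 2))))%R.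
    by apply: eq_Rintegral => x _; rewrite addrK; congr (_ * w _); ring.
  rewrite wE iter_cdiff_isolated subrK; last first.
    by move=> j jN; apply: f0; rewrite idxB sep.
  have [->|km] := eqVneq k m; first by rewrite subrr mul0r f1.
  by rewrite f0//; apply: le_trans (idx_far _ _ km); lra.
(* For [k != m] the centres are at distance at least [a >= 2 * e], so the supports do not
   overlap. *)
have hh k m : (\int[mu]_x (h k x * h m x))%R = (k == m)%:R * B.
  have [->|km] := eqVneq k m.
    have nk : bcsupp (fun x => h m x * h m x) by exact: bcsuppM.
    rewrite -(Rintegral_shift _ (idx m * a + N.+1%:R / 2) nk) mul1r.
    by apply: eq_Rintegral => x _; rewrite /h addrK.
  rewrite mul0r /Rintegral integral0_eq// => x _; congr (_%:E); rewrite /h.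
  have [/w0->|h1] := leP e `|x - (idx k * a + N.+1%:R / 2)|; first by rewrite mul0r.
  have [/w0->|h2] := leP e `|x - (idx m * a + N.+1%:R / 2)|; first by rewrite mulr0.
  have := idx_far _ _ km; rewrite leNgt => /negP[].
  rewrite (_ : (idx k - idx m) * a =
    (x - (idx m * a + N.+1%:R / 2)) - (x - (idx k * a + N.+1%:R / 2))); last by ring.
  by apply: le_lt_trans (ler_normB _ _) _; lra.
set P := \sum_i p i ^+ 2.
pose F x := \sum_i p i * g i x; pose H x := \sum_i p i * h i x.
have nF : bcsupp F by apply: bcsupp_sum => i; exact: bcsuppZ.
have nH : bcsupp H by apply: bcsupp_sum => i; exact: bcsuppZ.
have diag (d : R) : \sum_(i < n) \sum_(j < n) p i * p j * ((i == j)%:R * d) = P * d.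
  rewrite /P mulr_suml; apply: eq_bigr => i _; rewrite (bigD1 i)//= eqxx mul1r -expr2.
  by rewrite big1 ?addr0// => j ji; rewrite eq_sym (negbTE ji) mul0r mulr0.
have FH : (\int[mu]_x (F x * H x))%R = P.
  rewrite Rintegral_bilinear// -[RHS]mulr1 -diag.
  by apply: eq_bigr => i _; apply: eq_bigr => j _; rewrite gh mulr1.
have HH : (\int[mu]_x (H x * H x))%R = P * B.
  rewrite Rintegral_bilinear// -diag.
  by apply: eq_bigr => i _; apply: eq_bigr => j _; rewrite hh.
have nFF : bcsupp (fun x => F x * F x) by exact: bcsuppM.
have nFH : bcsupp (fun x => (- (2 * t)) * (F x * H x)) by apply: bcsuppZ; exact: bcsuppM.
have nHH : bcsupp (fun x => t ^+ 2 * (H x * H x)) by apply: bcsuppZ; exact: bcsuppM.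
have : 0 <= (\int[mu]_x (F x * F x + (- (2 * t) * (F x * H x) + t ^+ 2 * (H x * H x))))%R.
  apply: Rintegral_ge0 => x _.
  by rewrite (_ : _ + _ = (F x - t * H x) ^+ 2) ?sqr_ge0//; ring.
rewrite RintegralD//; [|exact: bcsupp_integrable|by apply: bcsupp_integrable; exact: bcsuppD].
rewrite RintegralD//; [|exact: bcsupp_integrable|exact: bcsupp_integrable].
rewrite RintegralZl//; last by apply: bcsupp_integrable; exact: bcsuppM.
rewrite RintegralZl//; last by apply: bcsupp_integrable; exact: bcsuppM.
rewrite FH HH => le0; rewrite -/t.
have -> : (\int[mu]_x ((\sum_i p i * bspline N.+1 (x - idx i * a)) ^+ 2))%R =
    (\int[mu]_x (F x * F x))%R by apply: eq_Rintegral => x _; rewrite expr2.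
have P0 : 0 <= P by apply: sumr_ge0 => i _; rewrite sqr_ge0.
have t0 : 0 < t by rewrite invr_gt0; lra.
(* The expansion bounds the squared norm of [F] below by [(2 * t - t^2 * B) * P], and this identity
   turns the factor into [t + t^2], which is at least [t]. *)
have tB : t * B = 1 - t by rewrite /t; field; lra.
have -> : t * P = 2 * t * P - t * (t * B) * P - t * t * P by rewrite tB; ring.
have : 0 <= t * t * P by rewrite !mulr_ge0// ltW.
nra.
Qed.

End Riesz.

(** * Hermitian matrices *)

Section Rayleigh.
Context {R : realType}.
Local Notation C := (R[i]).

(** In a unitary eigenbasis the form is a sum of [d 0 j] times squared moduli of coordinates, and
    each [d 0 j] is an eigenvalue with eigenvector [row j P]. *)
Lemma lambda1_rayleigh m (A : 'M[C]_m) (u : 'rV[C]_m) : A \is hermsymmx ->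
  (lambda1 A)%:C%C * (u *m u^t*) 0 0 <= (u *m A *m u^t*) 0 0.
Proof.
move=> Ah; have [m0|m0] := posnP m.
  by move: A u Ah; rewrite m0 => A u _; rewrite !mxE !big_ord0 mulr0.
have /orthomx_spectralP AE := hermitian_normalmx Ah.
have [_ lmin] := lambda1_hermitian m0 Ah.
set P := spectralmx A in AE; set d := spectral_diag A in AE.
have Pu : P \is unitarymx := spectral_unitarymx A.
have PP : P *m P^t* = 1%:M by apply/unitarymxP.
have Pi : invmx P = P^t* := invmx_unitary Pu.
have PP' : P^t* *m P = 1%:M by rewrite -Pi mulVmx// unitarymx_unit.
have dj j : (lambda1 A)%:C%C <= d 0 j.
  apply: lmin; apply/eigenvalueP; exists (row j P).
    have -> : row j P *m A = row j (diag_mx d *m P).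
      by rewrite -row_mul [in LHS]AE Pi !mulmxA PP mul1mx.
    by apply/rowP => k; rewrite mul_diag_mx !mxE.
  apply/negP => /eqP r0; have := congr1 (mulmxr (P^t* )) r0.
  rewrite /= -row_mul PP mul0mx => /rowP/(_ j); rewrite !mxE eqxx.
  by apply/eqP; exact: oner_neq0.
pose w := u *m P^t*.
have wt : w^t* = P *m u^t* by rewrite /w trmx_mul map_mxM trmxCK.
have -> : u *m u^t* = w *m w^t* by rewrite wt /w -mulmxA (mulmxA _ P) PP' mul1mx.
have -> : u *m A *m u^t* = w *m diag_mx d *m w^t*.
  by rewrite wt AE Pi /w !mulmxA.
rewrite !mxE mulr_sumr ler_sum// => j _.
rewrite mul_mx_diag !mxE mulrAC [leRHS]mulrC.
by apply: ler_wpM2r; [exact: mul_conjC_ge0 | exact: dj].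
Qed.

(** The needed half of Cauchy interlacing: a minimal eigenvector of the submatrix, extended by zero
    through the isometry [E], is a test vector for the Rayleigh bound. *)
Lemma lambda1_mxsub m n (s : 'I_n -> 'I_m) (A : 'M[C]_m) :
  (0 < n)%N -> injective s -> A \is hermsymmx -> mxsub s s A \is hermsymmx ->
  lambda1 (A) <= lambda1 (mxsub s s A).
Proof.
move=> n0 sI Ah Bh; have [/eigenvalueP[w wB w0] _] := lambda1_hermitian n0 Bh.
pose E : 'M[C]_(n, m) := rowsub s 1%:M.
have Et : E^t* = colsub s 1%:M.
  by apply/matrixP => i j; rewrite !mxE rmorph_nat eq_sym.
have EA : E *m A *m E^t* = mxsub s s A.
  rewrite Et -rowsubE; apply/matrixP => i j; rewrite !mxE (bigD1 (s j))//=.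
  rewrite !mxE eqxx mulr1 big1 ?addr0// => k ks.
  by rewrite !mxE (negbTE ks) mulr0.
have EE : E *m E^t* = 1%:M.
  by rewrite Et -rowsubE; apply/matrixP => i j; rewrite !mxE (inj_eq sI).
have := lambda1_rayleigh _ _ (w *m E) Ah.
rewrite trmx_mul map_mxM -!mulmxA (mulmxA A) (mulmxA E (A *m _)) (mulmxA E A) EA.
rewrite (mulmxA E) EE mul1mx (mulmxA w) wB -scalemxAl [X in _ <= X]mxE ler_pM2r ?lecR//.
by rewrite -dotmxE dnorm_gt0.
Qed.
End Rayleigh.

(** * Gram matrices *)

Section Gram.
Context {R : realType}.
Local Notation C := (R[i]).
Local Notation mu := (@lebesgue_measure R).
Implicit Types f h : R -> C.

Definition complex_bcsupp (f : R -> C) : Prop :=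
  bcsupp (fun x => complex.Re (f x)) /\ bcsupp (fun x => complex.Im (f x)).

(** [inner f h] unfolds to [cint] of the product of [f] and the conjugate of [h], so linearity is
    proved once here. *)
Definition cint (f : R -> C) : C :=
  ((\int[mu]_x complex.Re (f x))%R +i* (\int[mu]_x complex.Im (f x))%R)%C.

Lemma complex_bcsuppM f h : complex_bcsupp f -> complex_bcsupp h ->
  complex_bcsupp (fun x => f x * h x).
Proof.
move=> [fr fi] [hr hi]; split.
  have -> : (fun x => complex.Re (f x * h x)) = (fun x =>
      complex.Re (f x) * complex.Re (h x) + (- 1) * (complex.Im (f x) * complex.Im (h x))).
    by apply/funext => x; case: (f x) (h x) => [a b] [c d] /=; rewrite mulN1r.
  by apply: bcsuppD; [|apply: bcsuppZ]; exact: bcsuppM.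
have -> : (fun x => complex.Im (f x * h x)) = (fun x =>
    complex.Re (f x) * complex.Im (h x) + complex.Im (f x) * complex.Re (h x)).
  by apply/funext => x; case: (f x) (h x) => [a b] [c d] /=.
by apply: bcsuppD; exact: bcsuppM.
Qed.

Lemma complex_bcsupp_conj f : complex_bcsupp f -> complex_bcsupp (fun x => (f x)^*%C).
Proof.
move=> [fr fi]; split.
  by rewrite (_ : (fun _ => _) = (fun x => complex.Re (f x)))//; apply/funext => x; case: (f x).
rewrite (_ : (fun _ => _) = (fun x => (-1) * complex.Im (f x))); first exact: bcsuppZ.
by apply/funext => x; case: (f x) => a b /=; rewrite mulN1r.
Qed.

Lemma complex_bcsuppZ (c : C) f : complex_bcsupp f -> complex_bcsupp (fun x => c * f x).
Proof.
case: c => a b [fr fi]; split.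
  rewrite (_ : (fun _ => _) = (fun x => a * complex.Re (f x) + (- b) * complex.Im (f x))).
    by apply: bcsuppD; exact: bcsuppZ.
  by apply/funext => x; case: (f x) => c d /=; rewrite mulNr.
rewrite (_ : (fun _ => _) = (fun x => a * complex.Im (f x) + b * complex.Re (f x))).
  by apply: bcsuppD; exact: bcsuppZ.
by apply/funext => x; case: (f x) => c d /=.
Qed.

Lemma cintZ (c : C) f : complex_bcsupp f -> cint (fun x => c * f x) = c * cint f.
Proof.
case: c => a b [fr fi]; rewrite /cint.
have ir r := bcsupp_integrable _ (bcsuppZ r _ fr).
have ii r := bcsupp_integrable _ (bcsuppZ r _ fi).
have E1 : (\int[mu]_x complex.Re ((a +i* b)%C * f x))%R =
    (\int[mu]_x (a * complex.Re (f x) + (- b) * complex.Im (f x)))%R.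
  by apply: eq_Rintegral => x _; case: (f x) => c d /=; rewrite mulNr.
have E2 : (\int[mu]_x complex.Im ((a +i* b)%C * f x))%R =
    (\int[mu]_x (a * complex.Im (f x) + b * complex.Re (f x)))%R.
  by apply: eq_Rintegral => x _; case: (f x) => c d /=.
rewrite E1 E2 !RintegralD// !RintegralZl//; try exact: bcsupp_integrable.
by rewrite mulNr.
Qed.

Lemma cint_sum (I : Type) (s : seq I) (F : I -> R -> C) :
  (forall i, complex_bcsupp (F i)) ->
  cint (fun x => \sum_(i <- s) F i x) = \sum_(i <- s) cint (F i).
Proof.
move=> nF; rewrite /cint.
have -> : (\int[mu]_x complex.Re (\sum_(i <- s) F i x))%R =
    (\int[mu]_x \sum_(i <- s) complex.Re (F i x))%R.
  by apply: eq_Rintegral => x _; rewrite raddf_sum.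
have -> : (\int[mu]_x complex.Im (\sum_(i <- s) F i x))%R =
    (\int[mu]_x \sum_(i <- s) complex.Im (F i x))%R.
  by apply: eq_Rintegral => x _; rewrite raddf_sum.
rewrite !Rintegral_sum; [|by move=> i; case: (nF i)..].
elim: s => [|i s IH]; first by rewrite !big_nil.
by rewrite !big_cons -IH.
Qed.

Lemma complex_bcsupp_sum (I : Type) (s : seq I) (F : I -> R -> C) :
  (forall i, complex_bcsupp (F i)) -> complex_bcsupp (fun x => \sum_(i <- s) F i x).
Proof.
move=> nF; split.
  under eq_fun do rewrite raddf_sum.
  by apply: bcsupp_sum => i; case: (nF i).
under eq_fun do rewrite raddf_sum.
by apply: bcsupp_sum => i; case: (nF i).
Qed.

Lemma inner_conj f h : complex_bcsupp f -> complex_bcsupp h -> inner h f = (inner f h)^*%C.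
Proof.
move=> nf nh; rewrite /inner /=; congr (_ +i* _)%C.
  by apply: eq_Rintegral => x _; case: (f x) (h x) => [a b] [c d] /=; ring.
have [_ ni] := complex_bcsuppM _ _ nf (complex_bcsupp_conj _ nh).
rewrite -mulN1r -RintegralZl//; last exact: bcsupp_integrable.
by apply: eq_Rintegral => x _; case: (f x) (h x) => [a b] [c d] /=; ring.
Qed.

Section Family.
Variables (m : nat) (h : 'I_m -> R -> C).
Hypothesis nh : forall i, complex_bcsupp (h i).
Let A : 'M[C]_m := \matrix_(i, j) inner (h i) (h j).

Lemma gram_matrix_hermsym : A \is hermsymmx.
Proof.
apply/is_hermitianmxP; rewrite expr0 scale1r.
by apply/matrixP => i j; rewrite !mxE (inner_conj _ _ (nh j) (nh i)).
Qed.

(** The quadratic form is the integral of the squared modulus of [F], the combination of the family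
    with coefficients [v]. *)
Lemma gram_matrix_psd (v : 'rV[C]_m) : 0 <= (v *m A *m v^t*) 0 0.
Proof.
pose F x := \sum_i v 0 i * h i x.
have nvh i : complex_bcsupp (fun x => v 0 i * h i x) by exact: complex_bcsuppZ.
have -> : (v *m A *m v^t*) 0 0 = cint (fun x => F x * (F x)^*%C).
  rewrite !mxE; transitivity (\sum_j \sum_i cint (fun x => (v 0 i * h i x) * (v 0 j * h j x)^*%C)).
    apply: eq_bigr => j _; rewrite !mxE mulr_suml; apply: eq_bigr => i _.
    rewrite mxE mulrAC -cintZ; last by apply: complex_bcsuppM => //; exact: complex_bcsupp_conj.
    by congr cint; apply/funext => x; rewrite rmorphM /=; ring.
  have n2 i j : complex_bcsupp (fun x => (v 0 i * h i x) * (v 0 j * h j x)^*%C).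
    by apply: complex_bcsuppM => //; exact: complex_bcsupp_conj.
  under eq_bigr do rewrite -cint_sum//.
  rewrite -cint_sum; last by move=> j; exact: complex_bcsupp_sum.
  congr cint; apply/funext => x; rewrite /F rmorph_sum mulr_sumr.
  by apply: eq_bigr => j _; rewrite mulr_suml.
(* The order on complex numbers also demands equal imaginary parts, hence the separate first
   goal. *)
rewrite /cint lecE /=; apply/andP; split.
  rewrite (_ : \int[mu]_x _ = 0)%R// /Rintegral integral0_eq// => x _; congr (_%:E).
  by case: (F x) => a b /=; ring.
apply: Rintegral_ge0 => x _; case: (F x) => a b /=.
by rewrite mulrN opprK addr_ge0// -expr2 sqr_ge0.
Qed.

Lemma lambda1_gram_matrix_ge0 : (0 < m)%N -> 0 <= lambda1 A.
Proof.
move=> m0.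
have [/eigenvalueP[v vA v0] _] := lambda1_hermitian m0 gram_matrix_hermsym.
have := gram_matrix_psd v; rewrite vA -scalemxAl [X in _ <= X]mxE pmulr_lge0 ?lecR//.
by rewrite -dotmxE dnorm_gt0.
Qed.

End Family.
End Gram.

(** * The Gabor Gram matrix and its diagonal block *)

Section Atoms.
Context {R : realType}.
Local Notation mu := (@lebesgue_measure R).
Variables (g : R -> R) (a b : R).
Hypothesis ng : bcsupp g.

Lemma complex_bcsupp_atom (j k : R) : complex_bcsupp (atom g a b j k).
Proof.
have ngk : bcsupp (fun x => g (x - k * a)) by exact: bcsupp_shift.
have ml : measurable_fun setT (fun x : R => 2 * pi * j * b * x).
  exact: mulrl_measurable.
split.
  rewrite (_ : (fun _ => _) = (fun x => g (x - k * a) * cos (2 * pi * j * b * x))).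
    apply: (bcsuppMr _ _ 1) => // [|x]; last by rewrite ler_norml cos_geN1 cos_le1.
    apply: (measurableT_comp (f := @cos R)) => //.
    by apply: continuous_measurable_fun; exact: continuous_cos.
  by apply/funext => x; rewrite /= mul0r subr0.
rewrite (_ : (fun _ => _) = (fun x => g (x - k * a) * sin (2 * pi * j * b * x))).
  apply: (bcsuppMr _ _ 1) => // [|x]; last by rewrite ler_norml sin_geN1 sin_le1.
  apply: (measurableT_comp (f := @sin R)) => //.
  by apply: continuous_measurable_fun; exact: continuous_sin.
by apply/funext => x; rewrite /= mul0r addr0.
Qed.

Lemma mxvec_indexK n (j k : 'I_n) : mxvec_unindex (mxvec_index j k) = (j, k).
Proof. by rewrite /mxvec_unindex /mxvec_index cast_ordK enum_rankK. Qed.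

(** Projections in place of pattern matching exhibit the matrix as the Gram matrix of one family
    indexed by [p]. *)
Lemma gramE n : gram g a b n = \matrix_(p, q)
  inner (atom g a b (idx (mxvec_unindex p).1) (idx (mxvec_unindex p).2))
        (atom g a b (idx (mxvec_unindex q).1) (idx (mxvec_unindex q).2)).
Proof.
apply/matrixP => p q; rewrite !mxE.
by case: (mxvec_unindex p) (mxvec_unindex q) => [? ?] [].
Qed.

Lemma gram_hermsym n : gram g a b n \is hermsymmx.
Proof.
pose h p := atom g a b (idx (mxvec_unindex p).1) (idx (@mxvec_unindex n p).2).
by rewrite gramE; apply: (gram_matrix_hermsym _ h) => p; exact: complex_bcsupp_atom.
Qed.

Lemma lambda1_gram_ge0 n : (0 < n)%N -> 0 <= lambda1 (gram g a b n).
Proof.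
pose h p := atom g a b (idx (mxvec_unindex p).1) (idx (@mxvec_unindex n p).2).
move=> n0; rewrite gramE; apply: (lambda1_gram_matrix_ge0 _ h).
  by move=> p; exact: complex_bcsupp_atom.
by rewrite muln_gt0 n0.
Qed.

Lemma gram0_hermsym n : gram0 g a b n \is hermsymmx.
Proof. by apply: gram_matrix_hermsym => p; exact: complex_bcsupp_atom. Qed.

Lemma lambda1_gram_le n : (0 < n)%N ->
  lambda1 (gram g a b n) <= lambda1 (gram0 g a b n).
Proof.
(* This selects the block of the lowest modulation index rather than of [j = 0]; all diagonal blocks
   coincide by [inner_atom_same]. *)
move=> n0; pose s (k : 'I_n) := mxvec_index (Ordinal n0) k.
have gE : gram0 g a b n = mxsub s s (gram g a b n).
  by apply/matrixP => k k'; rewrite !mxE !mxvec_indexK !inner_atom_same.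
rewrite gE; apply: lambda1_mxsub => //.
- by move=> k k' /(congr1 (@mxvec_unindex n)); rewrite !mxvec_indexK => -[].
- exact: gram_hermsym.
- by rewrite -gE; exact: gram0_hermsym.
Qed.

(** The block has real entries and a real eigenvalue, so the real and imaginary parts of an
    eigenvector satisfy the same equation. One of them is nonzero, and the real lower bound applies
    to it. *)
Lemma lambda1_gram0_lower (c : R) n : (0 < n)%N ->
  (forall p : 'I_n -> R, c * (\sum_i p i ^+ 2) <=
    (\int[mu]_x ((\sum_i p i * g (x - idx i * a)) ^+ 2))%R) ->
  c <= lambda1 (gram0 g a b n).
Proof.
move=> n0 lb; have [/eigenvalueP[v vA v0] _] := lambda1_hermitian n0 (gram0_hermsym n).
set l := lambda1 _ in vA *.
pose r (k k' : 'I_n) := (\int[mu]_x (g (x - idx k * a) * g (x - idx k' * a)))%R.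
have vE k' : \sum_k v 0 k * (r k k')%:C%C = l%:C%C * v 0 k'.
  have /rowP/(_ k') := vA; rewrite !mxE => <-.
  by apply: eq_bigr => k _; rewrite mxE inner_atom_same.
(* For a real eigenvector the squared norm of the combination equals [l] times the sum of squares,
   which is compared with [lb]. *)
have key (p : 'I_n -> R) : (forall k', \sum_k p k * r k k' = l * p k') ->
    (exists k, p k != 0) -> c <= l.
  move=> pE [k0 pk0]; have P0 : 0 < \sum_i p i ^+ 2.
    rewrite (bigD1 k0)//= ltr_wpDr//; last by rewrite exprn_even_gt0.
    by apply: sumr_ge0 => i _; exact: sqr_ge0.
  rewrite -(ler_pM2r P0) (le_trans (lb p))//.
  under eq_Rintegral do rewrite expr2.
  rewrite (@Rintegral_bilinear R _ _ _ _ (fun i x => g (x - idx i * a))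
    (fun i x => g (x - idx i * a))); last 2 first.
  - by move=> i; exact: bcsupp_shift.
  - by move=> i; exact: bcsupp_shift.
  rewrite exchange_big mulr_sumr ler_sum// => k' _ /=.
  rewrite expr2 mulrA -pE mulr_suml ler_sum// => k _.
  by rewrite mulrAC.
have /rV0Pn[k vk] := v0.
have [rk|rk] := eqVneq (complex.Re (v 0 k)) 0.
  apply: (key (fun k => complex.Im (v 0 k))).
    move=> k'; have := congr1 (fun z => complex.Im z) (vE k').
    rewrite raddf_sum /= => E; transitivity (complex.Im (l%:C%C * v 0 k')).
      by rewrite -E; apply: eq_bigr => i _; case: (v 0 i) => x y /=; ring.
    by case: (v 0 k') => x y /=; ring.
  exists k; apply: contraNneq vk => ik.
  by move: rk ik; case: (v 0 k) => x y /= -> ->.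
apply: (key (fun k => complex.Re (v 0 k))); last by exists k.
move=> k'; have := congr1 (fun z => complex.Re z) (vE k').
rewrite raddf_sum /= => E; transitivity (complex.Re (l%:C%C * v 0 k')).
  by rewrite -E; apply: eq_bigr => i _; case: (v 0 i) => x y /=; ring.
by case: (v 0 k') => x y /=; ring.
Qed.

End Atoms.

Theorem corollary5p2p1 (R : realType) (N : nat) (a b : R) :
  (1 <= N)%N -> 0 < a -> 0 < b -> a * b < 1 ->
  let g : R -> R := bspline N in
  let D : set nat := [set n | odd n /\ (3 <= n)%N /\ 2 / a + 1 < n%:R] in
  lambda1 (gram0 g a b n) @[n --> within D \oo] --> (0 : R) ->
  (exists q : rat, a = ratr q) /\
  lambda1 (gram g a b n) @[n --> within D \oo] --> (0 : R).
Proof.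
move=> N1 a0 b0 ab g D lim0; have ng : bcsupp g by exact: bcsupp_bspline.
split; last first.
  apply: (@squeeze_cvgr _ _ _ _ (cst 0) (fun n => lambda1 (gram0 g a b n))) => //.
  - near=> n; have : D n by near: n; exact: withinT.
    move=> -[_ [n3 _]]; have n0 : (0 < n)%N by exact: leq_trans n3.
    by rewrite lambda1_gram_ge0// lambda1_gram_le.
  - exact: cvg_cst.
apply: contrapT => irr.
have [c [c0 lb]] := riesz_lower_bound a N.-1 a0 irr.
(* The stability bound is stated for order [N.+1], so it is applied to the predecessor of [N]. *)
have Ngt : N.-1.+1 = N by rewrite prednK.
have lbn n : (0 < n)%N -> c <= lambda1 (gram0 g a b n).
  by move=> n0; apply: lambda1_gram0_lower => // p; rewrite /g -Ngt; exact: lb.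
have /cvgrPdist_lt/(_ _ c0) := lim0.
move=> -[M _ HM].
pose K := (M + Num.bound (2 / a + 1))%N.
(* An odd index beyond both [M] and [2 / a + 1]: convergence within [D] gives a contradiction only
   at an actual member of [D]. *)
pose n := (K.*2 + 3)%N.
have Kn : (K <= n)%N by rewrite /n -addnn -addnA leq_addr.
have nD : D n.
  split; first by rewrite /n oddD odd_double.
  split; first by rewrite leq_addl.
  have : 2 / a + 1 < (Num.bound (2 / a + 1))%:R.
    by apply: archi_boundP; rewrite addr_ge0// divr_ge0// ltW.
  move=> /lt_le_trans; apply; rewrite ler_nat.
  by apply: leq_trans Kn; exact: leq_addl.
have := HM n; have n0 : (0 < n)%N by rewrite addn_gt0 orbT.
rewrite /= sub0r normrN => /(_ (leq_trans (leq_addr _ _) Kn) nD).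
have := lbn n n0 => h; rewrite ger0_norm ?ltNge ?h//.
by apply: le_trans h; exact: ltW.
Unshelve. all: by end_near.
Qed.
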